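(* Let $X$ be a real Banach space with $\dim X\ge 2$. The function $[0,1]\to[0,1]$, $\lambda\mapsto J_\lambda^\perp(X)$, is $2$-Lipschitz, that is, $$|J_\lambda^\perp(X)-J_\mu^\perp(X)|\le 2|\lambda-\mu|\qquad\text{for all }\lambda,\mu\in[0,1],$$ and it is continuous on $[0,1]$.
   Context: For a real Banach space $X$, $S_X=\{x\in X:\|x\|=1\}$. For $x,y\in X$, $x\perp_B y$ (Birkhoff--James orthogonality) means $\|x\|\le\|x+ty\|$ for every $t\in\mathbb R$. For $\lambda\in[0,1]$, $$J_\lambda^\perp(X)=\sup\{\min\{\|\lambda x+(1-\lambda)y\|,\|\lambda x-(1-\lambda)y\|\}: x,y\in S_X,\ x\perp_B y\}.$$ *)

(* Defs.v *)
From mathcomp Require Import all_boot all_order all_algebra.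
From mathcomp Require Import all_classical all_reals all_analysis.
Import Order.TTheory GRing.Theory Num.Theory.
Import numFieldNormedType.Exports.

Set Implicit Arguments.
Unset Strict Implicit.
Unset Printing Implicit Defensive.

Local Open Scope classical_set_scope.
Local Open Scope ring_scope.

(* X may be infinite-dimensional, so "dim X >= n" is stated as the existence
   of n linearly independent vectors. *)
Definition dim_ge (R : realType) (X : lmodType R) (n : nat) : Prop :=
  exists e : 'I_n -> X, forall c : 'I_n -> R,
    \sum_(i < n) c i *: e i = 0 -> forall i, c i = 0.

Definition unit_sphere (R : realType) (X : normedModType R) : set X :=
  [set x : X | `|x| = 1].

Definition birkhoff_orth (R : realType) (X : normedModType R) (x y : X) : Prop :=
  forall t : R, `|x| <= `|x + t *: y|.

(* The set is bounded above by 1 for l in [0, 1], and nonempty when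
   dim X >= 2, so the default value 0 of [sup] plays no role there. *)
Definition Jperp (R : realType) (X : normedModType R) (l : R) : R :=
  sup [set r : R | exists x y : X,
    [/\ unit_sphere x, unit_sphere y, birkhoff_orth x y &
        r = Num.min `|l *: x + (1 - l) *: y| `|l *: x - (1 - l) *: y|]].

Arguments dim_ge {R} X n.
Arguments Jperp {R} X l.

(* Main.v *)
Require Import Defs.
From mathcomp Require Import all_boot all_order all_algebra.
From mathcomp Require Import all_classical all_reals all_analysis.
Import Order.TTheory GRing.Theory Num.Theory.
Import numFieldNormedType.Exports.

(** The pairs over which the supremum is taken do not depend on the parameter:
    [Jperp X l] is the pointwise supremum at [l] of the family
    [l |-> min (`|l x + (1 - l) y|, `|l x - (1 - l) y|)] indexed by the
    Birkhoff-James orthogonal pairs [(x, y)] of unit vectors.  For fixed unit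
    vectors, changing [l] to [m] moves [l x + (1 - l) y] by [(l - m) (x - y)],
    a vector of norm at most [2 |l - m|], and the same holds with [- y] in place
    of [y] ([norm_combo_lip]).  A minimum of two 2-Lipschitz functions is
    2-Lipschitz, and a uniform Lipschitz bound passes to the pointwise supremum
    ([sup_image_leD]).  For [0 <= l <= 1] the members of the family lie in
    the unit interval because [l x + (1 - l) y] is a convex combination of unit vectors;
    this bounds [Jperp], and continuity on the interval follows from the
    Lipschitz estimate. *)

Local Open Scope classical_set_scope.
Local Open Scope ring_scope.

(** Each [f i] is at most [sup g + c], so [sup f] is too; used in both
    directions, it carries a uniform Lipschitz bound over to the supremum. *)
Lemma sup_image_leD (R : realType) (I : Type) (D : set I) (f g : I -> R)
    (c : R) : 0 <= c -> has_ubound (g @` D) ->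
  (forall i, D i -> f i <= g i + c) -> sup (f @` D) <= sup (g @` D) + c.
Proof.
move=> c0 ubg fg; have [->|/set0P[i Di]] := eqVneq D set0.
  (* Both suprema take the default value 0 on the empty set. *)
  by rewrite !image_set0 !sup0 add0r.
apply: ge_sup; first by exists (f i), i.
move=> _ [j Dj <-]; apply: (le_trans (fg _ Dj)); rewrite lerD2r.
by apply: ub_le_sup => //; exists j.
Qed.

Lemma lipschitz_within_continuous (R : realType) (A : set R) (f : R -> R)
    (k : R) : (forall x y, A x -> A y -> `|f x - f y| <= k * `|x - y|) ->
  {within A, continuous f}.
Proof.
move=> fk; apply/subspace_continuousP => x Ax.
apply/cvgrPdist_le => e e0.
(* [k] may be nonpositive; [`|k| + 1] is a positive Lipschitz constant. *)
have k0 : 0 < `|k| + 1 by rewrite ltr_wpDl.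
have : \forall y \near x, `|x - y| <= e / (`|k| + 1).
  by apply: (@cvgr_dist_le _ _ _ (nbhs x) _ id x); [exact: cvg_id|rewrite divr_gt0].
rewrite /within /=; apply: filterS => y xy Ay.
apply: (le_trans (fk _ _ Ax Ay)).
move: xy; rewrite ler_pdivlMr// mulrC; apply: le_trans.
by rewrite ler_wpM2r// (le_trans (ler_norm k))// lerDl.
Qed.

Section Combination.
Context {R : realType} {X : normedModType R}.
Implicit Types (x y : X) (l m : R).

Lemma norm_combo_le1 x y l : `|x| = 1 -> `|y| = 1 -> 0 <= l <= 1 ->
  `|l *: x + (1 - l) *: y| <= 1.
Proof.
move=> x1 y1 /andP[l0 l1]; apply: (le_trans (ler_normD _ _)).
by rewrite !normrZ x1 y1 !mulr1 !ger0_norm ?subr_ge0// addrC subrK.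
Qed.

Lemma norm_combo_lip x y l m : `|x| = 1 -> `|y| = 1 ->
  `|l *: x + (1 - l) *: y| <= `|m *: x + (1 - m) *: y| + 2 * `|l - m|.
Proof.
move=> x1 y1.
have -> : l *: x + (1 - l) *: y = m *: x + (1 - m) *: y + (l - m) *: (x - y).
  rewrite scalerBr addrACA -scalerDl -scalerBl (addrC m) subrK.
  by congr (_ + _ *: _); rewrite opprB addrA subrK.
apply: (le_trans (ler_normD _ _)); rewrite lerD2l normrZ mulrC ler_wpM2r//.
by apply: (le_trans (ler_normB _ _)); rewrite x1 y1.
Qed.

Definition min_combo l (p : X * X) : R :=
  Num.min `|l *: p.1 + (1 - l) *: p.2| `|l *: p.1 - (1 - l) *: p.2|.

Lemma min_combo_ge0 l p : 0 <= min_combo l p.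
Proof. by rewrite /min_combo le_min !normr_ge0. Qed.

Lemma min_combo_le1 l p : `|p.1| = 1 -> `|p.2| = 1 -> 0 <= l <= 1 ->
  min_combo l p <= 1.
Proof. by move=> p1 p2 l01; rewrite /min_combo ge_min norm_combo_le1. Qed.

Lemma min_combo_lip l m p : `|p.1| = 1 -> `|p.2| = 1 ->
  min_combo l p <= min_combo m p + 2 * `|l - m|.
Proof.
move=> p1 p2; rewrite /min_combo addr_minl le_min !ge_min norm_combo_lip//=.
have := @norm_combo_lip p.1 (- p.2) l m p1.
by rewrite !scalerN normrN => ->//; rewrite orbT.
Qed.

End Combination.

Definition orth_pairs {R : realType} (X : normedModType R) : set (X * X) :=
  [set p | [/\ unit_sphere p.1, unit_sphere p.2 & birkhoff_orth p.1 p.2]].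

Lemma JperpE (R : realType) (X : normedModType R) (l : R) :
  Jperp X l = sup (min_combo l @` orth_pairs X).
Proof.
congr sup; apply/seteqP; split => [r [x [y [x1 y1 xy ->]]]|_ [[x y] [x1 y1 xy] <-]].
  by exists (x, y).
by exists x, y.
Qed.

Lemma min_combo_ubound (R : realType) (X : normedModType R) (l : R) :
  0 <= l <= 1 -> ubound (min_combo l @` orth_pairs X) 1.
Proof. by move=> l01 _ [p [p1 p2 _] <-]; exact: min_combo_le1. Qed.

Lemma Jperp_bounds (R : realType) (X : normedModType R) (l : R) :
  0 <= l <= 1 -> 0 <= Jperp X l <= 1.
Proof.
move=> l01; rewrite JperpE; have ub := @min_combo_ubound R X l l01.
have [->|/set0P[p Dp]] := eqVneq (orth_pairs X) set0.
  by rewrite image_set0 sup0 lexx ler01.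
apply/andP; split; last by apply: ge_sup => //; exists (min_combo l p), p.
apply: (le_trans (min_combo_ge0 l p)); apply: ub_le_sup; first by exists 1.
by exists p.
Qed.

Lemma Jperp_leD (R : realType) (X : normedModType R) (l m : R) :
  0 <= m <= 1 -> Jperp X l <= Jperp X m + 2 * `|l - m|.
Proof.
move=> m01; rewrite !JperpE; apply: sup_image_leD.
- by rewrite mulr_ge0.
- by exists 1; exact: min_combo_ubound.
- by move=> p [p1 p2 _]; exact: min_combo_lip.
Qed.

Lemma Jperp_lipschitz (R : realType) (X : normedModType R) (l m : R) :
  0 <= l <= 1 -> 0 <= m <= 1 -> `|Jperp X l - Jperp X m| <= 2 * `|l - m|.
Proof.
move=> l01 m01; rewrite ler_norml lerBlDl Jperp_leD// andbT.
by rewrite lerBrDl lerBlDr distrC Jperp_leD.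
Qed.

Theorem proposition3p4 (R : realType) (X : completeNormedModType R)
    (hX : dim_ge X 2) :
  [/\ (forall l : R, 0 <= l <= 1 -> 0 <= Jperp X l <= 1),
      (forall l m : R, 0 <= l <= 1 -> 0 <= m <= 1 ->
         `|Jperp X l - Jperp X m| <= 2 * `|l - m|) &
      {within `[0, 1], continuous (Jperp X)}].
Proof.
split; [exact: Jperp_bounds|exact: Jperp_lipschitz|].
apply: (@lipschitz_within_continuous R _ _ 2) => l m /=; rewrite !in_itv /=.
exact: Jperp_lipschitz.
Qed.
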